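(* Let $G$ be any graph on $n$ vertices with maximum degree $\Delta=\Delta(G)\ge 3$, let $H=L(G)$ be its line graph, and let $H^c$ be the complement of $H$. Then $\mathrm{box}(H^c)\le n-2$. Moreover: (i) if $\Delta=3$, then $\mathrm{box}(H^c)\ge \dfrac{|E(H)|}{12}$; (ii) if $\Delta=4$, then $\mathrm{box}(H^c)\ge \dfrac{|E(H)|}{16}$; (iii) if $\Delta\ge 5$, then $\mathrm{box}(H^c)\ge \dfrac{2|E(H)|}{\Delta^2+3\Delta}$.
   Context: Graphs are finite and simple. An axis-parallel $d$-dimensional box is a cartesian product $I_1\times I_2\times\dots\times I_d$ where each $I_i$ is a closed sub-interval of the real line (the whole line $\mathbb R$ is allowed). For a graph $F=(V,E)$, the boxicity $\mathrm{box}(F)$ is the minimum dimension $d\geq 0$ such that $F$ is the intersection graph of a family $(B_v)_{v\in V}$ of $d$-dimensional axis-parallel boxes in $\mathbb R^d$, i.e. distinct $u,v\in V$ are adjacent if and only if $B_u\cap B_v\ne\varnothing$. The line graph $L(G)$ of $G$ has vertex set $E(G)$, two distinct edges of $G$ being adjacent in $L(G)$ if they share an endvertex. *)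

(* Defs.v *)
From HB Require Import structures.
From mathcomp Require Export all_boot all_order all_algebra.
From mathcomp Require Export boolp classical_sets reals topology normedtype.
Set Implicit Arguments.
Unset Strict Implicit.
Unset Printing Implicit Defensive.
Import Order.TTheory GRing.Theory Num.Theory.
Import numFieldNormedType.Exports.

Record sgraph := SGraph {
  vertex :> finType;
  adj : rel vertex;
  adj_sym : symmetric adj;
  adj_irr : irreflexive adj }.

Definition edges (G : sgraph) : {set {set G}} :=
  [set [set p.1; p.2] | p : G * G & adj p.1 p.2]%SET.

Definition degree (G : sgraph) (x : G) : nat := #|[set y | adj x y]%SET|.

Definition max_degree (G : sgraph) : nat := (\max_(x : G) degree x)%N.

Section Complement.
Variable G : sgraph.

Definition compl_adj : rel G := fun x y => (x != y) && ~~ adj x y.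

Lemma compl_adj_sym : symmetric compl_adj.
Proof. by move=> x y; rewrite /compl_adj eq_sym adj_sym. Qed.

Lemma compl_adj_irr : irreflexive compl_adj.
Proof. by move=> x; rewrite /compl_adj eqxx. Qed.

Definition compl_graph : sgraph := SGraph compl_adj_sym compl_adj_irr.
End Complement.

Section LineGraph.
Variable G : sgraph.

Definition line_vertex : finType := {e : {set G} | e \in edges G}.

Definition line_adj : rel line_vertex :=
  fun e f => (e != f) && [exists x : G, (x \in val e) && (x \in val f)].

Lemma line_adj_sym : symmetric line_adj.
Proof.
move=> e f; rewrite /line_adj eq_sym; congr (_ && _).
by apply: eq_existsb => x; rewrite andbC.
Qed.

Lemma line_adj_irr : irreflexive line_adj.
Proof. by move=> e; rewrite /line_adj eqxx. Qed.

Definition line_graph : sgraph := SGraph line_adj_sym line_adj_irr.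
End LineGraph.

Local Open Scope classical_set_scope.
Local Open Scope ring_scope.

Section Boxicity.
Variable R : realType.

(* The bounds may be infinite, so half-lines and the whole line are included. *)
Definition closed_interval (I : set R) : Prop :=
  [/\ I !=set0, is_interval I & closed I].

Definition is_box (d : nat) (B : set 'rV[R]_d) : Prop :=
  exists2 I : 'I_d -> set R, (forall i, closed_interval (I i)) &
    B = [set x | forall i, I i (x ord0 i)].

Definition box_representable (F : sgraph) (d : nat) : Prop :=
  exists2 B : F -> set 'rV[R]_d, (forall v, is_box (B v)) &
    forall u v, u != v -> (adj u v <-> B u `&` B v !=set0).

Lemma closed_interval_itv (a b : R) : a <= b -> closed_interval `[a, b].
Proof.
move=> ab; split; last exact: interval_closed.
  by exists a; rewrite /= in_itv /= lexx.
exact: interval_is_interval.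
Qed.

(* Roberts: one coordinate per vertex v, in which v gets {0}, its neighbours
   get [0, 1] and all the other vertices get {1}. *)
Lemma box_representable_card (F : sgraph) : box_representable F #|F|.
Proof.
pose lo (v : F) (i : 'I_#|F|) : R :=
  if (v == enum_val i) || adj v (enum_val i) then 0 else 1.
pose hi (v : F) (i : 'I_#|F|) : R := if v == enum_val i then 0 else 1.
exists (fun v => [set x | forall i, x ord0 i \in `[lo v i, hi v i]]).
  move=> v; exists (fun i => [set` `[lo v i, hi v i]]) => // i.
  apply: closed_interval_itv; rewrite /lo /hi.
  by case: eqP => //= _; case: ifP.
move=> u v uv; split=> [auv|].
  exists (\row_i (if (u == enum_val i) || (v == enum_val i) then 0 else 1)).
  split=> i /=; rewrite in_itv /= mxE /lo /hi.
    case: (u =P enum_val i) => [_|_] /=; first by rewrite lexx.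
    case: (v =P enum_val i) => [<-|_]; first by rewrite auv lexx ler01.
    by rewrite lexx andbT; case: ifP.
  case: (v =P enum_val i) => [_|_] /=; first by rewrite orbT lexx.
  rewrite orbF; case: (u =P enum_val i) => [<-|_].
    by rewrite adj_sym auv lexx ler01.
  by rewrite lexx andbT; case: ifP.
case=> x [/(_ (enum_rank v)) + /(_ (enum_rank v))].
rewrite /= !in_itv /= /lo /hi enum_rankK eqxx (negbTE uv) /=.
case: (adj u v) => // /andP[x1 _] /andP[_ x0].
by have := le_trans x1 x0; rewrite ler10.
Qed.

Lemma box_representable_ex (F : sgraph) : exists d, `[< box_representable F d >].
Proof. by exists #|F|; apply/asboolP/box_representable_card. Qed.

Definition boxicity (F : sgraph) : nat := ex_minn (box_representable_ex F).
End Boxicity.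

(* Main.v *)
(* The complement of H has boxicity at most d if and only if the edges of H are
   covered by d interval orders on E(G) whose comparable pairs are edges of H,
   that is, pairs of edges of G sharing an endvertex.

   Upper bound: fix two vertices b and c. The n - 2 orders are indexed by the
   vertices a other than b and c: the edges at a form a chain from ab to ac,
   ab precedes every other edge at b, and every other edge at c precedes ac.

   Lower bound: such an order has at most max(4D, (D^2 + 3D)/2) comparable
   pairs. If it has any, it has some pair ab < ac such that ab precedes every
   edge with a predecessor and ac follows every edge with a successor. So
   e < f forces e to meet ac and f to meet ab, which leaves the pairs at a, at
   most 2(D - 1) pairs ab < bz and cz < ac, and the exceptional pairs ax < bx,
   cx < ax, cx < bx, bc < bz and cz < bc. As the order is 2+2-free, each of the
   first three exceptional types occurs at most once, and the presence of the
   others makes most pairs at a incomparable. *)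
From mathcomp Require Import zify lra.
Require Import Defs.
From mathcomp Require Import fintype finset.
Set Implicit Arguments.
Unset Strict Implicit.
Unset Printing Implicit Defensive.
Import Order.TTheory GRing.Theory Num.Theory.
Local Open Scope ring_scope.

(** * Edges as two-element sets of vertices *)

Lemma edgesP (G : sgraph) (e : {set G}) :
  reflect (exists2 p : G * G, adj p.1 p.2 & e = [set p.1; p.2]%SET)
          (e \in edges G).
Proof.
apply: (iffP imsetP) => -[p]; last by exists p; rewrite ?inE.
by rewrite inE; exists p.
Qed.

Lemma mem_edges2 (G : sgraph) (x y : G) :
  ([set x; y]%SET \in edges G) = adj x y.
Proof.
apply/edgesP/idP => [[[u v] /= auv exy]|axy]; last by exists (x, y).
have uv : u != v by apply/eqP => uv; rewrite uv adj_irr in auv.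
have xy : x != y.
  by have := cards2 u v; rewrite -exy cards2 uv; case: (x == y).
have := set21 x y; have := set22 x y; rewrite exy !inE.
move=> /orP[/eqP yE|/eqP yE] /orP[/eqP xE|/eqP xE]; subst => //.
- by rewrite eqxx in xy.
- by rewrite adj_sym.
- by rewrite eqxx in xy.
Qed.

Lemma edges_at (G : sgraph) (e : {set G}) (a : G) :
  e \in edges G -> a \in e -> exists x, e = [set a; x]%SET.
Proof.
case/edgesP => -[u v] /= _ ->; rewrite !inE => /orP[] /eqP ->.
  by exists v.
by exists u; rewrite setUC.
Qed.

(** * Interval orders on edges whose comparable pairs meet *)

Section EdgeOrders.
Variable G : sgraph.
Implicit Types (Q : rel {set G}) (a b c x y z : G) (e f : {set G}).
Local Open Scope nat_scope.

(* A relation is an interval order if and only if it is irreflexive and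
   2+2-free; transitivity follows. *)
Record meeting_interval_order Q : Prop := MeetingIntervalOrder {
  mio_edges : forall e f, Q e f -> e \in edges G /\ f \in edges G;
  mio_meet : forall e f, Q e f -> exists2 x, x \in e & x \in f;
  mio_irr : forall e, ~ Q e e;
  mio_free22 : forall e f e' f', Q e f -> Q e' f' -> Q e f' \/ Q e' f }.

Record extremes Q a b c : Prop := Extremes {
  ext_neq : b <> c;
  ext_bc : Q [set a; b]%SET [set a; c]%SET;
  ext_min : forall e f, Q e f -> Q [set a; b]%SET f;
  ext_max : forall e f, Q e f -> Q e [set a; c]%SET }.

(** Reversal exchanges [b] and [c] in [extremes], so each statement about exits on the side of [b]
    also serves the side of [c]. *)
Definition opp_rel Q : rel {set G} := fun e f => Q f e.

Lemma opp_mio Q :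
  meeting_interval_order Q -> meeting_interval_order (opp_rel Q).
Proof.
case=> Qe Qm Qi Q22; split; rewrite /opp_rel.
- by move=> e f /Qe[].
- by move=> e f /Qm[x]; exists x.
- exact: Qi.
- by move=> e f e' f' fe fe'; case: (Q22 _ _ _ _ fe fe'); [right|left].
Qed.

Lemma opp_extremes Q a b c : extremes Q a b c -> extremes (opp_rel Q) a c b.
Proof.
case=> bc Qbc Qmin Qmax; split; rewrite /opp_rel //; first by move/esym.
- by move=> e f /Qmax.
- by move=> e f /Qmin.
Qed.

Definition star_pairs Q a : {set G * G} :=
  [set p | Q [set a; p.1]%SET [set a; p.2]%SET]%SET.

Definition inner_star_pairs Q a b c : {set G * G} :=
  [set p in star_pairs Q a | (p.1 != b) && (p.2 != c)]%SET.

(* The vertices [x] with [ax < bx]; the vertices [x] with [cx < ax] are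
   [star_exits (opp_rel Q) a c]. *)
Definition star_exits Q a b : {set G} :=
  [set x | (x != b) && Q [set a; x]%SET [set b; x]%SET]%SET.

(** For the reversed order, [base_exits (opp_rel Q) c b] collects the [z] with [cz < bc]. *)
Definition base_exits Q b c : {set G} :=
  [set z | (z != c) && Q [set b; c]%SET [set b; z]%SET]%SET.

Definition crossings Q b c : {set G} :=
  [set x | Q [set c; x]%SET [set b; x]%SET]%SET.

Definition nbrs a : {set G} := [set x | adj a x]%SET.

Section Pairs.
Variables (Q : rel {set G}).
Hypothesis Qmio : meeting_interval_order Q.

Lemma mio_trans e f g : Q e f -> Q f g -> Q e g.
Proof.
by move=> ef fg; case: (mio_free22 Qmio ef fg) => // /(mio_irr Qmio).
Qed.

Lemma mio_adj x y z w :
  Q [set x; y]%SET [set z; w]%SET -> adj x y /\ adj z w.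
Proof. by move/(mio_edges Qmio); rewrite !mem_edges2. Qed.

Lemma mio_neq x y z w : Q [set x; y]%SET [set z; w]%SET -> x <> y /\ z <> w.
Proof.
by move/mio_adj => [xy zw]; split=> E; [move: xy|move: zw]; rewrite E adj_irr.
Qed.

Lemma mio_meet2 x y z w : Q [set x; y]%SET [set z; w]%SET ->
  [\/ x = z, x = w, y = z | y = w].
Proof.
case/(mio_meet Qmio) => u; rewrite !inE.
by move=> /orP[] /eqP-> /orP[] /eqP->;
  [apply: Or41|apply: Or42|apply: Or43|apply: Or44].
Qed.

End Pairs.

Ltac disjoint_edges Qmio H :=
  let H' := fresh in
  have H' := mio_meet2 Qmio H; exfalso; case: H' => ?; congruence.

(** * Classification of the comparable pairs around the two extreme edges *)

Section Extremes.
Variables (Q : rel {set G}) (a b c : G).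
Hypothesis Qmio : meeting_interval_order Q.
Hypothesis Qext : extremes Q a b c.

Let bc := ext_neq Qext.
Let Qbc := ext_bc Qext.

Lemma ext_adj : adj a b /\ adj a c.
Proof. exact: mio_adj Qbc. Qed.

Let ab : a <> b. Proof. by case: (mio_neq Qmio Qbc). Qed.
Let ac : a <> c. Proof. by case: (mio_neq Qmio Qbc). Qed.

Lemma ext_noprec e : ~ Q e [set a; b]%SET.
Proof. by move/(ext_min Qext)/(mio_irr Qmio). Qed.

Lemma ext_nosucc f : ~ Q [set a; c]%SET f.
Proof. by move/(ext_max Qext)/(mio_irr Qmio). Qed.

(** For [x != y], the 2+2-free condition on [ax < bx] and [ay < by] gives [ax < by] or [ay < bx],
    but these edges are disjoint. *)
Lemma card_star_exits : #|star_exits Q a b| <= 1.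
Proof.
apply/card_le1_eqP => x y; rewrite !inE => /andP[/eqP xb Hx] /andP[/eqP yb Hy].
have [_ bx] := mio_neq Qmio Hx; have [ax _] := mio_neq Qmio Hx.
have [_ by_] := mio_neq Qmio Hy; have [ay _] := mio_neq Qmio Hy.
have [// |/eqP xy] := eqVneq x y.
by case: (mio_free22 Qmio Hx Hy) => H; disjoint_edges Qmio H.
Qed.

Lemma card_crossings : #|crossings Q b c| <= 1.
Proof.
apply/card_le1_eqP => x y; rewrite !inE => Hx Hy.
have [cx bx] := mio_neq Qmio Hx; have [cy by_] := mio_neq Qmio Hy.
have [// |/eqP xy] := eqVneq x y.
by case: (mio_free22 Qmio Hx Hy) => H; disjoint_edges Qmio H.
Qed.

(** If [e < f], extremality makes [e] meet [ac] and [f] meet [ab]. The families [s1] to [s8] arise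
    by asking whether [a] lies in [e] and in [f], and where the two edges meet. *)
Lemma card_pairs :
  #|[set p : {set G} * {set G} | Q p.1 p.2]%SET| <=
    #|star_pairs Q a|
    + (#|nbrs b :\ a| + #|star_exits Q a b|)
    + (#|nbrs c :\ a| + #|star_exits (opp_rel Q) a c|)
    + (#|base_exits Q b c| + #|base_exits (opp_rel Q) c b|
       + #|crossings Q b c|).
Proof.
pose s1 :=
  ((fun p : G * G => ([set a; p.1], [set a; p.2])) @: star_pairs Q a)%SET.
pose s2 := ((fun z => ([set a; b], [set b; z])) @: (nbrs b :\ a))%SET.
pose s3 := ((fun z => ([set a; z], [set b; z])) @: star_exits Q a b)%SET.
pose s4 := ((fun z => ([set c; z], [set a; c])) @: (nbrs c :\ a))%SET.
pose s5 := ((fun z => ([set c; z], [set a; z])) @: star_exits (opp_rel Q) a c)%SET.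
pose s6 := ((fun z => ([set b; c], [set b; z])) @: base_exits Q b c)%SET.
pose s7 := ((fun z => ([set c; z], [set c; b])) @: base_exits (opp_rel Q) c b)%SET.
pose s8 := ((fun z => ([set c; z], [set b; z])) @: crossings Q b c)%SET.
have sub : [set p : {set G} * {set G} | Q p.1 p.2]%SET
    \subset (s1 :|: (s2 :|: s3) :|: (s4 :|: s5) :|: (s6 :|: s7 :|: s8))%SET.
  apply/subsetP => -[e f]; rewrite !in_setU inE /= => Qef.
  have [eE fE] := mio_edges Qmio Qef.
  have De : (exists x, e = [set a; x]%SET) \/
            exists2 y, e = [set c; y]%SET & y != a.
    have [ae|ae] := boolP (a \in e); first by left; apply: edges_at.
    have [x] := mio_meet Qmio (ext_max Qext Qef).
    move=> xe; rewrite !inE => /orP[]/eqP xE; subst x; first by rewrite xe in ae.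
    right; have [y Ey] := edges_at eE xe; exists y => //.
    by apply: contraNneq ae => <-; rewrite Ey set22.
  have Df : (exists x, f = [set a; x]%SET) \/
            exists2 z, f = [set b; z]%SET & z != a.
    have [af|af] := boolP (a \in f); first by left; apply: edges_at.
    have [x] := mio_meet Qmio (ext_min Qext Qef).
    rewrite !inE => /orP[]/eqP xE xf; subst x; first by rewrite xf in af.
    right; have [y Ey] := edges_at fE xf; exists y => //.
    by apply: contraNneq af => <-; rewrite Ey set22.
  case: De => [[x Ee]|[y Ee ya]]; case: Df => [[x' Ef]|[z Ef za]]; subst e f;
    have [Ne Nf] := mio_neq Qmio Qef; have [Ae Af] := mio_adj Qmio Qef.
  - suff -> : ([set a; x], [set a; x'])%SET \in s1 by [].
    by apply/imsetP; exists (x, x'); rewrite ?inE.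
  - have [->|/eqP xb] := eqVneq x b.
      suff -> : ([set a; b], [set b; z])%SET \in s2 by rewrite !(orbT, orTb).
      by apply/imsetP; exists z; rewrite ?inE ?za.
    suff -> : ([set a; x], [set b; z])%SET \in s3 by rewrite !(orbT, orTb).
    have xz : x = z.
      by case: (mio_meet2 Qmio Qef) => // E; move/eqP: za; congruence.
    subst z; apply/imsetP; exists x => //.
    by rewrite !inE Qef andbT; apply/eqP.
  - have [->|/eqP xc] := eqVneq x' c.
      suff -> : ([set c; y], [set a; c])%SET \in s4 by rewrite !(orbT, orTb).
      by apply/imsetP; exists y; rewrite ?inE ?ya.
    suff -> : ([set c; y], [set a; x'])%SET \in s5 by rewrite !(orbT, orTb).
    have xz : y = x'.
      by case: (mio_meet2 Qmio Qef) => // E; move/eqP: ya; congruence.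
    subst y; apply/imsetP; exists x' => //.
    by rewrite !inE /opp_rel Qef andbT; apply/eqP.
  (* Here [cy < bz] and both edges avoid [a], so they meet through [y = b], [z = c] or [y = z]. *)
  - have [yb|/eqP yb] := eqVneq y b.
      suff -> : ([set c; y], [set b; z])%SET \in s6 by rewrite !(orbT, orTb).
      subst y; apply/imsetP; exists z; last by rewrite setUC.
      rewrite inE setUC Qef andbT; apply/eqP => zc.
      by apply: (mio_irr Qmio (e := [set b; c])); rewrite -{2}zc setUC.
    have [zc|/eqP zc] := eqVneq z c.
      suff -> : ([set c; y], [set b; z])%SET \in s7 by rewrite !(orbT, orTb).
      subst z; apply/imsetP; exists y; last by rewrite (setUC [set b]).
      rewrite inE /opp_rel (setUC [set c] [set b]) Qef andbT; exact/eqP.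
    suff -> : ([set c; y], [set b; z])%SET \in s8 by rewrite !(orbT, orTb).
    have yz : y = z by case: (mio_meet2 Qmio Qef) => // E; congruence.
    by subst z; apply/imsetP; exists y; rewrite ?inE.
apply: leq_trans (subset_leq_card sub) _.
by do ![apply: (leq_trans (leq_card_setU _ _)); apply: leq_add |
  apply: leq_imset_card].
Qed.

Lemma star_pairs_nbrs p : p \in star_pairs Q a ->
  [/\ p.1 \in nbrs a, p.2 \in nbrs a & p.1 <> p.2].
Proof.
rewrite !inE => H; have [-> ->] := mio_adj Qmio H; split=> // E.
by rewrite E in H; case: (mio_irr Qmio H).
Qed.

Lemma card_nbrs2 : #|nbrs a| = #|nbrs a :\ b :\ c|.+2.
Proof.
have [aab aac] := ext_adj.
rewrite (cardsD1 b) inE aab (cardsD1 c) !inE aac andbT.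
by have /eqP := bc; rewrite eq_sym => ->.
Qed.

(* Every edge at [a] other than the two extremes accounts for two of the pairs
   involving an extreme, and the extremes themselves form one more. *)
Lemma card_star_pairs_inner :
  #|star_pairs Q a| <= 2 * #|nbrs a| - 3 + #|inner_star_pairs Q a b c|.
Proof.
pose s1 := setX [set b]%SET (nbrs a :\ b)%SET.
pose s2 := setX (nbrs a :\ b :\ c)%SET [set c]%SET.
have sub : star_pairs Q a \subset
    (s1 :|: s2 :|: inner_star_pairs Q a b c)%SET.
  apply/subsetP => -[x y] Hxy; have [/= xa ya xy] := star_pairs_nbrs Hxy.
  rewrite in_setU [in X in _ || X]inE Hxy /= !inE in xa ya *.
  rewrite xa ya.
  have [xb|xb] := eqVneq x b; have [yc|yc] := eqVneq y c => //=.
  - by subst x y; rewrite eq_sym; move/eqP: bc ->.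
  - by subst x; rewrite !andbT; move/eqP: xy; rewrite eq_sym => ->.
  - by subst y; rewrite !andbT; move/eqP: xy => ->; rewrite ?orbT.
  - by rewrite !orbT.
apply: leq_trans (subset_leq_card sub) _.
apply: leq_trans (leq_card_setU _ _) _; rewrite leq_add2r.
apply: leq_trans (leq_card_setU _ _) _.
rewrite /s1 /s2 !cardsX !cards1 card_nbrs2.
have := card_nbrs2; rewrite (cardsD1 b (nbrs a)) !inE.
case: ext_adj => -> _ /=; lia.
Qed.

(** [D] holds ordered pairs of distinct neighbours whose edges at [a] are incomparable. With the
    star pairs, their transposes and the diagonal it fits disjointly into the square of [nbrs a]. *)
Lemma card_star_pairs_opp (D : {set G * G}) :
  D \subset setX (nbrs a) (nbrs a) ->
  (forall p, p \in D ->
     [/\ p.1 <> p.2, p \notin star_pairs Q a & (p.2, p.1) \notin star_pairs Q a]) ->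
  2 * #|star_pairs Q a| + #|D| <= #|nbrs a| * (#|nbrs a| - 1).
Proof.
move=> subD HD.
pose tr (p : G * G) := (p.2, p.1).
pose dg (x : G) := (x, x).
have trI : injective tr by move=> [x y] [z w] [-> ->].
have dgI : injective dg by move=> x y [].
pose T := (tr @: star_pairs Q a)%SET; pose I := (dg @: nbrs a)%SET.
have trT p : (p \in T) = (tr p \in star_pairs Q a).
  by case: p => x y; rewrite -[(x, y)]/(tr (y, x)) /T mem_imset.
have cT : #|T| = #|star_pairs Q a| by rewrite card_imset.
have cI : #|I| = #|nbrs a| by rewrite card_imset.
have d1 : (star_pairs Q a :&: T = set0)%SET.
  apply/eqP; rewrite -subset0; apply/subsetP => -[x y].
  rewrite inE trT !inE /= => /andP[xy yx].
  by case: (mio_irr Qmio (mio_trans Qmio xy yx)).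
have d2 : ((star_pairs Q a :|: T) :&: I = set0)%SET.
  apply/eqP; rewrite -subset0; apply/subsetP => p.
  rewrite inE in_setU => /andP[+ /imsetP[x _ xE]]; subst p.
  by rewrite trT /tr /= orbb => /star_pairs_nbrs[_ _ /(_ erefl)].
have d3 : ((star_pairs Q a :|: T :|: I) :&: D = set0)%SET.
  apply/eqP; rewrite -subset0; apply/subsetP => p.
  rewrite inE => /andP[+ /HD[pp p1 p2]].
  rewrite !in_setU trT (negbTE p1) (negbTE p2) /= => /imsetP[x _ xE].
  by case: pp; rewrite xE.
have sub : (star_pairs Q a :|: T :|: I :|: D)%SET \subset setX (nbrs a) (nbrs a).
  rewrite !subUset subD andbT; apply/andP; split; last first.
    by apply/subsetP => p /imsetP[x xa ->]; rewrite in_setX xa.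
  apply/andP; split; apply/subsetP => p; rewrite [p \in setX _ _]inE.
    by case/star_pairs_nbrs => -> ->.
  by rewrite trT => /star_pairs_nbrs[/= -> ->].
have := subset_leq_card sub.
rewrite cardsU d3 cardsU d2 cardsU d1 !cards0 !subn0 cT cI cardsX mulnBr muln1; lia.
Qed.

Lemma card_star_pairs : 2 * #|star_pairs Q a| <= #|nbrs a| * (#|nbrs a| - 1).
Proof.
have := @card_star_pairs_opp set0; rewrite sub0set cards0 addn0.
by apply=> // p; rewrite inE.
Qed.

(* If [cx < bx], two edges at [a] that avoid [b], [c] and [x] are
   incomparable. *)
Lemma card_star_pairs_crossing : 4 < #|nbrs a| -> crossings Q b c != set0 ->
  2 * #|star_pairs Q a| + 2 <= #|nbrs a| * (#|nbrs a| - 1).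
Proof.
move=> d5 /set0Pn[x]; rewrite inE => Hx.
have incomp y y' : y \notin [:: b; c; x] -> y' \notin [:: b; c; x] ->
    (y, y') \notin star_pairs Q a.
  rewrite !inE !negb_or => /and3P[/eqP ? /eqP ? /eqP ?].
  move=> /and3P[/eqP ? /eqP ? /eqP ?]; apply/negP => /= Hy.
  have [??] := mio_neq Qmio Hx; have [??] := mio_neq Qmio Hy.
  have [ax|/eqP ax] := eqVneq a x.
    subst x; apply: (@ext_nosucc [set b; a]%SET).
    by rewrite setUC.
  by case: (mio_free22 Qmio Hx Hy) => H; disjoint_edges Qmio H.
have c2 : 1 < #|nbrs a :\ b :\ c :\ x|.
  move: d5; rewrite card_nbrs2 (cardsD1 x (_ :\ _)%SET); lia.
case/card_gt1P: c2 => y [y' [+ + /eqP yy]].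
rewrite !inE => /and4P[yx yc yb ya] /and4P[yx' yc' yb' ya'].
have ny : y \notin [:: b; c; x] by rewrite !inE !negb_or yx yc yb.
have ny' : y' \notin [:: b; c; x] by rewrite !inE !negb_or yx' yc' yb'.
have := @card_star_pairs_opp [set (y, y'); (y', y)].
rewrite cards2 xpair_eqE; move/eqP/negbTE: (yy) => ->; apply.
  by rewrite subUset !sub1set !inE /= ya ya'.
move=> p; rewrite in_set2 => /orP[] /eqP -> /=.
  by split; rewrite ?incomp.
by split; rewrite ?incomp //; move/esym.
Qed.

(** A base exit makes [bc] an edge, so [a] and [c] are two neighbours of [b]. Neither is a base
    exit, [a] because nothing precedes [ab]. *)
Lemma card_base_exits :
  base_exits Q b c != set0 -> #|base_exits Q b c| <= #|nbrs b| - 2.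
Proof.
case/set0Pn => z0; rewrite inE => /andP[_ /(mio_adj Qmio)[abc _]].
have sub : base_exits Q b c \subset (nbrs b :\ a :\ c)%SET.
  apply/subsetP => z; rewrite !inE => /andP[-> Hz].
  have [_ ->] := mio_adj Qmio Hz; rewrite andbT /=.
  by apply/eqP => za; subst z; rewrite (setUC [set b] [set a]) in Hz; case: (ext_noprec Hz).
apply: leq_trans (subset_leq_card sub) _.
have [aab _] := ext_adj.
rewrite (cardsD1 a (nbrs b)) inE adj_sym aab (cardsD1 c (nbrs b :\ a)%SET) !inE abc.
by move/eqP: ac; rewrite eq_sym => -> /=; lia.
Qed.

(* An edge [bc] below [bz] can only precede edges at [b] or [c], so [ay] is not
   above [bc] and every predecessor of [ay] precedes [bz]. *)
Lemma base_exit_prec z e y : z \in base_exits Q b c -> y <> b -> y <> c ->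
  Q e [set a; y]%SET -> Q e [set b; z]%SET.
Proof.
rewrite inE => /andP[/eqP zc Hz] yb yc He.
case: (mio_free22 Qmio Hz He) => // H; disjoint_edges Qmio H.
Qed.

(** For an inner pair [ax < ay], [base_exit_prec] yields [ax < bz], and these edges can only meet
    through [x = z]. *)
Lemma base_exit_inner z p :
  z \in base_exits Q b c -> p \in inner_star_pairs Q a b c ->
  p.1 = z /\ p.2 \in (nbrs a :\ b :\ c :\ z)%SET.
Proof.
case: p => x y zE; rewrite inE => /andP[Hxy /= /andP[/eqP xb /eqP yc]].
have [/= xa ya xy] := star_pairs_nbrs Hxy; move: Hxy; rewrite inE /= => Hxy.
have yb : y <> b by move=> yb; subst y; case: (ext_noprec Hxy).
have H := base_exit_prec zE yb yc Hxy.
have [Ne Nf] := mio_neq Qmio H.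
move: zE; rewrite inE => /andP[_ Hz].
have az : a <> z.
  by move=> az; subst z; rewrite (setUC [set b] [set a]) in Hz; case: (ext_noprec Hz).
have xz : x = z by case: (mio_meet2 Qmio H) => // ?; congruence.
split=> //; rewrite !in_setD1 ya andbT.
by apply/and3P; split; apply/eqP; congruence.
Qed.

Lemma base_exit_star z y : z \in base_exits Q b c ->
  y \in star_exits (opp_rel Q) a c -> y = z.
Proof.
move=> zE; rewrite inE /opp_rel => /andP[/eqP yc Hy].
have yb : y <> b by move=> yb; subst y; case: (ext_noprec Hy).
have H := base_exit_prec zE yb yc Hy.
move: zE; rewrite inE => /andP[/eqP zc Hz].
by case: (mio_meet2 Qmio H) => // ?; congruence.
Qed.

(** All inner pairs start at the same base exit [z], and their second vertex avoids [b], [c] and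
    [z]. *)
Lemma card_inner_star_pairs : base_exits Q b c != set0 ->
  #|inner_star_pairs Q a b c| <= #|nbrs a| - 3.
Proof.
case/set0Pn => z zE.
have [->|/set0Pn[p pE]] := eqVneq (inner_star_pairs Q a b c) set0.
  by rewrite cards0.
have za : z \in (nbrs a :\ b :\ c)%SET.
  have [<- _] := base_exit_inner zE pE.
  move: pE; rewrite inE => /andP[H /andP[p1 p2]].
  rewrite !in_setD1 p1; have [-> _ _] := star_pairs_nbrs H; rewrite !andbT.
  apply/eqP => pc; move: H; rewrite inE pc; exact: ext_nosucc.
have sub : inner_star_pairs Q a b c \subset
    setX [set z]%SET (nbrs a :\ b :\ c :\ z)%SET.
  apply/subsetP => q qE; have [q1 q2] := base_exit_inner zE qE.
  by rewrite inE q2 in_set1 q1 eqxx.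
apply: leq_trans (subset_leq_card sub) _.
rewrite cardsX cards1 card_nbrs2 (cardsD1 z (_ :\ c)%SET) za; lia.
Qed.

(** Otherwise both involve the same [z], and [cz < az < ay] compares the disjoint edges [cz] and
    [ay]. *)
Lemma base_exits_inner_or_star : base_exits Q b c != set0 ->
  inner_star_pairs Q a b c = set0 \/ star_exits (opp_rel Q) a c = set0.
Proof.
case/set0Pn => z zE.
have [->|/set0Pn[[x y] pE]] := eqVneq (inner_star_pairs Q a b c) set0; first by left.
have [->|/set0Pn[t tE]] := eqVneq (star_exits (opp_rel Q) a c) set0; first by right.
have tz := base_exit_star zE tE; subst t.
have [/= xz] := base_exit_inner zE pE; subst x.
rewrite !inE => /and4P[/eqP yz /eqP yc _ _].
move: pE tE; rewrite !inE /opp_rel /= => /andP[Hy _] /andP[_ Hz].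
have [Ny _] := mio_neq Qmio Hy.
have H := mio_trans Qmio Hz Hy; disjoint_edges Qmio H.
Qed.

(** An inner pair or a star exit at [c] determines the base exit. *)
Lemma two_base_exits : 1 < #|base_exits Q b c| ->
  inner_star_pairs Q a b c = set0 /\ star_exits (opp_rel Q) a c = set0.
Proof.
case/card_gt1P => z [z' [zE zE' /eqP zz]]; split; apply/eqP; rewrite -subset0.
  apply/subsetP => p pE; have [p1 _] := base_exit_inner zE pE.
  by have [p1' _] := base_exit_inner zE' pE; congruence.
apply/subsetP => y yE; have := base_exit_star zE yE.
by have := base_exit_star zE' yE; congruence.
Qed.

End Extremes.

(** * Bounding the number of comparable pairs by cases *)

Section CountPairs.
Variables (Q : rel {set G}) (a b c : G) (D : nat).
Hypothesis Qmio : meeting_interval_order Q.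
Hypothesis Qext : extremes Q a b c.
Hypothesis degD : forall x, #|nbrs x| <= D.

Let count := #|[set p : {set G} * {set G} | Q p.1 p.2]%SET|.

Lemma count_le : count <= #|star_pairs Q a| + 2 * (D - 1)
    + (#|star_exits Q a b| + #|star_exits (opp_rel Q) a c|)
    + (#|base_exits Q b c| + #|base_exits (opp_rel Q) c b| + #|crossings Q b c|).
Proof.
have [aab aac] := ext_adj Qmio Qext.
have := card_pairs Qmio Qext; rewrite -/count.
have := degD b; rewrite (cardsD1 a) inE adj_sym aab.
have := degD c; rewrite (cardsD1 a) inE adj_sym aac; lia.
Qed.

(** The separate bounds give twice the count at most [D ^ 2 + 3 * D], plus 2 if there is a crossing.
    For [D <= 4] the excess fits below [8 * D]. For larger [D], either [a] has five neighbours and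
    the crossing excludes a star pair, or twice the number of star pairs is at most 12. *)
Lemma count_no_base : 3 <= D ->
  base_exits Q b c = set0 -> base_exits (opp_rel Q) c b = set0 ->
  2 * count <= maxn (8 * D) (D ^ 2 + 3 * D).
Proof.
move=> D3 Z0 Y0.
have := count_le; rewrite Z0 Y0 !cards0.
have := card_star_exits Qmio Qext.
have := card_star_exits (opp_mio Qmio) (opp_extremes Qext).
have := card_crossings Qmio Qext.
have := card_star_pairs Qmio Qext.
have := card_star_pairs_crossing Qmio Qext.
have := degD a.
rewrite -card_gt0; set d := #|nbrs a|; set s := #|star_pairs Q a|.
move: #|star_exits _ _ _| #|star_exits _ _ _| #|crossings _ _ _| => u v x.
move=> dD h1 h2 xle vle ule tot.
have mono : d * (d - 1) <= D * (D - 1) by apply: leq_mul => //; lia.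
rewrite leq_max; apply/orP.
have [D4|D5] := leqP D 4.
  left; have [?|?] : D = 3 \/ D = 4 by lia.
    subst D; lia.
  subst D; lia.
right; have [d5|d5] := ltnP 4 d; first by nia.
have : d * (d - 1) <= 4 * 3 by apply: leq_mul => //; lia.
nia.
Qed.

(** Base exits on one side only leave fewer than [4 * D] or at most [5 * D - 5] pairs. Exits on both
    sides are unique and exclude inner pairs, which leaves at most [4 * D]. *)
Lemma count_base : 3 <= D -> base_exits Q b c != set0 ->
  2 * count <= maxn (8 * D) (D ^ 2 + 3 * D).
Proof.
move=> D3 Z0.
have tot := count_le.
have ule := card_star_exits Qmio Qext.
have vle := card_star_exits (opp_mio Qmio) (opp_extremes Qext).
have xle := card_crossings Qmio Qext.
have sle := card_star_pairs_inner Qmio Qext.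
have zle := card_base_exits Qmio Qext Z0.
have ile := card_inner_star_pairs Qmio Qext Z0.
have da := degD a; have db := degD b.
have a2 := card_nbrs2 Qmio Qext.
(* For [D >= 5] this is [(D - 2)(D - 5) >= 0]. *)
have quad : 10 * D - 10 <= maxn (8 * D) (D ^ 2 + 3 * D).
  rewrite leq_max; have [D4|D5] := leqP D 4; apply/orP; [left|right]; [lia|nia].
have [Y0|/set0Pn[y yE]] := eqVneq (base_exits (opp_rel Q) c b) set0.
  rewrite Y0 cards0 in tot.
  have [Z1|Z2] := leqP #|base_exits Q b c| 1.
    have [I0|U0] := base_exits_inner_or_star Qmio Qext Z0.
      by rewrite I0 cards0 in sle; lia.
    by rewrite U0 cards0 in tot; lia.
  have [I0 U0] := two_base_exits Qmio Qext Z2.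
  by rewrite I0 cards0 in sle; rewrite U0 cards0 in tot; lia.
(* By transitivity [ct < bc < bz], so [ct] and [bz] meet. *)
have yz z t : z \in base_exits Q b c -> t \in base_exits (opp_rel Q) c b -> t = z.
  rewrite !inE /opp_rel => /andP[/eqP zc Hz] /andP[/eqP tb Ht].
  rewrite (setUC [set c] [set b]) in Ht.
  have H := mio_trans Qmio Ht Hz.
  have bc := ext_neq Qext.
  by case: (mio_meet2 Qmio H) => // ?; congruence.
have [z zE] := set0Pn _ Z0.
have Z1 : #|base_exits Q b c| <= 1.
  by apply/card_le1_eqP => s t /yz/(_ yE) <- /yz/(_ yE) <-.
have Y1 : #|base_exits (opp_rel Q) c b| <= 1.
  by apply/card_le1_eqP => s t /(yz _ _ zE) -> /(yz _ _ zE) ->.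
(* An inner pair would have [z] as its first vertex and, by reversal, also as its second. *)
have I0 : inner_star_pairs Q a b c = set0.
  apply/eqP; rewrite -subset0; apply/subsetP => -[s t] pE.
  have [_] := base_exit_inner Qmio Qext zE pE.
  have pE' : (t, s) \in inner_star_pairs (opp_rel Q) a c b.
    by move: pE; rewrite !inE /opp_rel /= andbA andbAC => /andP[/andP[-> ->] ->].
  have [/= -> _] := base_exit_inner (opp_mio Qmio) (opp_extremes Qext) yE pE'.
  by rewrite (yz _ _ zE yE) !inE eqxx.
rewrite I0 cards0 in sle.
by rewrite leq_max; apply/orP; left; lia.
Qed.

End CountPairs.

Lemma card_pairs_opp Q :
  #|[set p : {set G} * {set G} | opp_rel Q p.1 p.2]%SET| =
  #|[set p : {set G} * {set G} | Q p.1 p.2]%SET|.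
Proof.
pose tr (p : {set G} * {set G}) := (p.2, p.1).
have trI : injective tr by move=> [x y] [z w] [-> ->].
rewrite -(card_imset _ trI); congr #|pred_of_set _|; apply/setP => -[x y].
by rewrite -[(x, y)]/(tr (y, x)) mem_imset // !inE.
Qed.

(** Successor sets of a 2+2-free relation are nested, so an edge with the most successors precedes
    every edge that has a predecessor. Reversal gives the other extreme; the two are comparable and
    hence share a vertex [a]. *)
Lemma exists_extremes Q e f : meeting_interval_order Q -> Q e f ->
  exists a b c, extremes Q a b c.
Proof.
move=> Qmio Qef.
have min_of R e0 f0 : meeting_interval_order R -> R e0 f0 ->
    exists m, forall s t, R s t -> R m t.
  move=> Rmio R0.
  have [m _ mmax] := @arg_maxnP _ e0 predT (fun s => #|[set t | R s t]%SET|) isT.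
  exists m => s t st; apply: contraT => mt.
  have sub : [set t | R m t]%SET \subset [set t | R s t]%SET.
    apply/subsetP => w; rewrite !inE => mw.
    by case: (mio_free22 Rmio mw st) => // H; rewrite H in mt.
  have : [set t | R m t]%SET \proper [set t | R s t]%SET.
    by rewrite properE sub; apply/subsetPn; exists t; rewrite inE.
  by move/proper_card; rewrite ltnNge; have := mmax s isT; rewrite /= => ->.
have [m mP] := min_of _ _ _ Qmio Qef.
have [M MP] := min_of _ _ _ (opp_mio Qmio) (Qef : opp_rel Q f e).
have QmM : Q m M by apply: MP (mP _ _ Qef).
have [a am aM] := mio_meet Qmio QmM.
have [mE ME] := mio_edges Qmio QmM.
have [b mab] := edges_at mE am; have [c Mac] := edges_at ME aM.
exists a, b, c; subst m M; split=> //.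
- by move=> bc; rewrite bc in QmM; case: (mio_irr Qmio QmM).
- by move=> s t st; apply: MP st.
Qed.

Lemma count_mio Q D : meeting_interval_order Q -> 3 <= D ->
  (forall x : G, #|nbrs x| <= D) ->
  2 * #|[set p : {set G} * {set G} | Q p.1 p.2]%SET|
    <= maxn (8 * D) (D ^ 2 + 3 * D).
Proof.
move=> Qmio D3 degD.
have [->|/set0Pn[[e f]]] :=
  eqVneq [set p : {set G} * {set G} | Q p.1 p.2]%SET set0; first by rewrite cards0.
rewrite inE => /(exists_extremes Qmio)[a [b [c Qext]]].
have [Z0|] := eqVneq (base_exits Q b c) set0; last exact: count_base Qext degD D3.
have [Y0|] := eqVneq (base_exits (opp_rel Q) c b) set0.
  exact: count_no_base Qext degD D3 Z0 Y0.
rewrite -card_pairs_opp.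
exact: count_base (opp_mio Qmio) (opp_extremes Qext) degD D3.
Qed.

End EdgeOrders.

(** * Upper bound: a box representation in dimension [n - 2] *)

Section UpperBound.
Variables (R : realType) (G : sgraph).
Local Open Scope nat_scope.

Lemma boxicity_le (F : sgraph) d : box_representable R F d -> boxicity R F <= d.
Proof.
by move=> Fd; rewrite /boxicity; case: ex_minnP => m _; apply; apply/asboolP.
Qed.

Lemma box_representable_boxicity (F : sgraph) : box_representable R F (boxicity R F).
Proof. by rewrite /boxicity; case: ex_minnP => m /asboolP. Qed.

(** Closed intervals meet exactly when each starts no later than the other ends; natural endpoints
    reduce the construction to arithmetic. *)
Lemma box_representable_nat (F : sgraph) d (lo hi : F -> 'I_d -> nat) :
  (forall v i, lo v i <= hi v i) ->
  (forall u v, u != v ->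
     adj u v <-> forall i, lo u i <= hi v i /\ lo v i <= hi u i) ->
  box_representable R F d.
Proof.
move=> lohi Hadj.
exists (fun v => [set x : 'rV[R]_d | forall i,
  (x ord0 i \in `[(lo v i)%:R, (hi v i)%:R])%R]%classic).
  move=> v; exists (fun i => [set` `[(lo v i)%:R, (hi v i)%:R]%R]%classic) => // i.
  by apply: closed_interval_itv; rewrite ler_nat.
move=> u v uv; rewrite Hadj //; split=> [H|[x [/= xu xv]] i].
  exists (\row_i (maxn (lo u i) (lo v i))%:R)%R.
  split=> i /=; have [luv lvu] := H i; rewrite in_itv /= mxE !ler_nat geq_max.
    by rewrite leq_maxl lohi lvu.
  by rewrite leq_maxr lohi luv.
have := xu i; have := xv i; rewrite !in_itv /= => /andP[x1 x2] /andP[x3 x4].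
by split; rewrite -(ler_nat R); [exact: le_trans x3 x2|exact: le_trans x1 x4].
Qed.

Variables b c : G.
Hypothesis bc : b != c.

(* In coordinate [a], an edge [ax] is the point [p x], so that [ab] is leftmost
   and [ac] is rightmost. Any other edge is an interval, as large as possible
   subject to avoiding [ab] if it contains [b], and [ac] if it contains [c]. *)
Let p (x : G) := if x == b then 0 else if x == c then #|G|.+1 else (enum_rank x).+1.
Let pos a (e : {set G}) := \max_(x in e :\ a) p x.
Let lo a (e : {set G}) : nat := if a \in e then pos a e else b \in e.
Let hi a (e : {set G}) : nat := if a \in e then pos a e else #|G| + (c \notin e).

Let pos2 a x : a != x -> pos a [set a; x]%SET = p x.
Proof.
move=> ax; rewrite /pos setU1K ?big_set1 //.
by rewrite in_set1.
Qed.

Let p_inj : injective p.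
Proof.
move=> x y; rewrite /p.
have [->|xb] := eqVneq x b; have [->|yb] := eqVneq y b => //; try by case: ifP.
have [->|xc] := eqVneq x c; have [->|yc] := eqVneq y c => //.
- by move=> [E]; have := ltn_ord (enum_rank y); rewrite -E ltnn.
- by move=> [E]; have := ltn_ord (enum_rank x); rewrite E ltnn.
- by move=> [/ord_inj/enum_rank_inj].
Qed.

Let p_gt0 x : x != b -> 0 < p x.
Proof. by rewrite /p => /negbTE ->; case: ifP. Qed.

Let p_le x : x != c -> p x <= #|G|.
Proof. by rewrite /p => /negbTE ->; case: ifP => // _; apply: ltn_ord. Qed.

Let p_leS x : p x <= #|G|.+1.
Proof.
rewrite /p; case: ifP => // _; case: ifP => // _.
by apply: ltnW; apply: ltn_ord.
Qed.

Let card_vertices_gt0 : 0 < #|G|.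
Proof. by apply/card_gt0P; exists b. Qed.

Let edge_at e a : e \in edges G -> a \in e ->
  exists2 x, e = [set a; x]%SET & a != x.
Proof.
move=> eE ae; have [x Ex] := edges_at eE ae; exists x => //.
by apply/eqP => ax; move: eE; rewrite Ex mem_edges2 ax adj_irr.
Qed.

(** Vertex [b] sits at 0, [c] at [#|G|.+1] and all others between 1 and [#|G|]. So the interval of
    an edge avoiding [a] misses the point [p x] of [ax] only if [x] is [b] or [c] and lies in both
    edges. *)
Let lo_le_hi a e f : e \in edges G -> f \in edges G ->
  e = f \/ (forall x, x \in e -> x \in f -> False) -> lo a e <= hi a f.
Proof.
move=> eE fE [<-|dis]; rewrite /lo /hi.
  by case: ifP => // _; case: (b \in e); case: (c \in e); have := card_vertices_gt0; lia.
case: ifPn => ae; case: ifPn => af.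
- by case: (dis a).
- have [x Ex ax] := edge_at eE ae; rewrite Ex pos2 //.
  have [cf|cf] := boolP (c \in f); last by rewrite addn1 p_leS.
  rewrite addn0 p_le //; apply/eqP => xc; apply: (dis c) => //.
  by rewrite Ex xc set22.
- have [x Ex ax] := edge_at fE af; rewrite Ex pos2 //.
  have [be|//] := boolP (b \in e).
  apply: p_gt0; apply/eqP => xb; apply: (dis b) => //.
  by rewrite Ex xb set22.
- by case: (b \in e); have := card_vertices_gt0; lia.
Qed.

(** If the edges meet in [s] outside [b] and [c], they are distinct points in coordinate [s]. If
    [s = b], the coordinate is the other end of one of the edges, chosen different from [c]: that
    edge is the point 0, while the other starts at 1. The case [s = c] is symmetric. *)
Let separated e f : e \in edges G -> f \in edges G -> e != f ->
  (exists x, (x \in e) && (x \in f)) ->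
  exists2 a, a \notin [set b; c]%SET & (hi a e < lo a f) || (hi a f < lo a e).
Proof.
move=> eE fE ef [s /andP[se sf]].
have [x Ex sx] := edge_at eE se; have [y Ey sy] := edge_at fE sf.
have xy : x != y by apply: contraNneq ef => xy; rewrite Ex Ey xy.
have other t u : t != u -> s != t -> s != u -> t \notin [set s; u]%SET.
  by rewrite !inE negb_or => -> st _; rewrite eq_sym st.
have at_b t u : s = b -> t != c -> s != t -> s != u -> t != u ->
    (t \notin [set b; c]%SET) && (hi t [set s; t]%SET < lo t [set s; u]%SET).
  move=> sb tc st su tu; rewrite !inE negb_or tc -sb eq_sym st /=.
  rewrite /hi /lo set22 (negbTE (other _ _ _ _ _)) //.
  by rewrite setUC pos2 1?eq_sym // -sb set21 /p sb eqxx.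
have at_c t u : s = c -> t != b -> s != t -> s != u -> t != u ->
    (t \notin [set b; c]%SET) && (hi t [set s; u]%SET < lo t [set s; t]%SET).
  move=> sc tb st su tu; rewrite !inE negb_or tb -sc eq_sym st /=.
  rewrite /hi /lo set22 (negbTE (other _ _ _ _ _)) //.
  rewrite (setUC [set s] [set t]) pos2 1?eq_sym // -sc set21 /p sc eqxx.
  by rewrite eq_sym (negbTE bc) addn0.
rewrite Ex Ey.
have [sb|sb] := eqVneq s b.
  have [xc|xc] := eqVneq x c.
    have yc : y != c by rewrite -xc eq_sym.
    have yx : y != x by rewrite eq_sym.
    by have /andP[? H] := at_b y x sb yc sy sx yx; exists y; rewrite // H orbT.
  by have /andP[? H] := at_b x y sb xc sx sy xy; exists x; rewrite // H.
have [sc|sc] := eqVneq s c.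
  have [xb|xb] := eqVneq x b.
    have yb : y != b by rewrite -xb eq_sym.
    have yx : y != x by rewrite eq_sym.
    by have /andP[? H] := at_c y x sc yb sy sx yx; exists y; rewrite // H.
  by have /andP[? H] := at_c x y sc xb sx sy xy; exists x; rewrite // H orbT.
exists s; first by rewrite !inE negb_or sb.
by rewrite /lo /hi !set21 !pos2 // -neq_ltn; apply: contraNneq xy => /p_inj ->.
Qed.

Lemma box_representable_compl_line :
  box_representable R (compl_graph (line_graph G)) (#|G| - 2).
Proof.
have -> : #|G| - 2 = #|~: [set b; c]%SET| by rewrite cardsCs setCK cards2 bc.
pose v (i : 'I_#|~: [set b; c]%SET|) := enum_val i.
apply: (@box_representable_nat (compl_graph (line_graph G)) _
  (fun (e : line_graph G) i => lo (v i) (val e)) (fun (e : line_graph G) i => hi (v i) (val e))).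
  by move=> e i; apply: lo_le_hi; [exact: valP|exact: valP|left].
move=> e f ef; rewrite /= /compl_adj /= /line_adj ef /=; split.
  rewrite negb_exists => /forallP dis i.
  split; apply: lo_le_hi; try exact: valP; right=> x xe xf.
    by have := dis x; rewrite xe xf.
  by have := dis x; rewrite xe xf.
move=> H; apply/negP => /existsP es.
have vef : val e != val f by [].
have [a aC0 sep] := separated (valP e) (valP f) vef es.
have aC : a \in (~: [set b; c])%SET by rewrite inE aC0.
have [] := H (enum_rank_in aC a); rewrite /v enum_rankK_in //.
by move=> l1 l2; move: sep; rewrite !ltnNge l1 l2.
Qed.

End UpperBound.

(** * Lower bound: interval orders read off a box representation *)

Section LowerBound.
Variables (R : realType) (G : sgraph).

Lemma disjoint_intervals_lt (I J : set R) (x0 y0 : R) :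
  is_interval I -> is_interval J -> (forall x, ~ (I x /\ J x)) ->
  I x0 -> J y0 -> x0 < y0 -> forall x y, I x -> J y -> x < y.
Proof.
move=> Ii Ij dis Ix0 Jy0 xy0 x y Ix Jy; rewrite ltNge; apply/negP => yx.
have [x0y|yx0] := leP x0 y.
  by apply: (dis y); split=> //; apply: (Ii _ _ Ix0 Ix); rewrite x0y.
by apply: (dis x0); split=> //; apply: (Ij _ _ Jy Jy0); rewrite !ltW.
Qed.

(** Coordinate [i] orders the edges of [G] by lying wholly to the left. Comparable edges have
    disjoint boxes, hence meet in [G]. Conversely, distinct meeting edges have boxes disjoint in
    some coordinate, where they are comparable. So the [d] orders cover the edges of the line
    graph. *)
Lemma card_edges_line d M :
  box_representable R (compl_graph (line_graph G)) d ->
  (forall Q : rel {set G}, meeting_interval_order Q ->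
     (2 * #|[set p : {set G} * {set G} | Q p.1 p.2]%SET| <= M)%N) ->
  (2 * #|edges (line_graph G)| <= d * M)%N.
Proof.
move=> [B Bbox Badj] HM.
have /choice [I HI] : forall v, exists I : 'I_d -> set R,
    (forall i, closed_interval (I i)) /\
    B v = [set x | forall i, I i (x ord0 i)]%classic.
  by move=> v; have [I I1 I2] := Bbox v; exists I.
have Iint v i : is_interval (I v i) by have [/(_ i)[]] := HI v.
have Ine v i : exists x, I v i x by have [/(_ i)[]] := HI v.
pose lt i (u v : line_graph G) : bool :=
  `[< forall x y, I u i x -> I v i y -> x < y >].
have lt_irr i u : lt i u u = false.
  apply/negP => /asboolP H; have [x Ix] := Ine u i.
  by have := H x x Ix Ix; rewrite ltxx.
have lt_adj i u v : lt i u v -> adj u v.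
  move=> uv; have neq : u != v by apply: contraTneq uv => ->; rewrite lt_irr.
  apply: contraT => nadj.
  have [x []] : (B u `&` B v !=set0)%classic.
    by apply/(Badj u v neq); rewrite /= /compl_adj neq.
  have [_ ->] := HI u; have [_ ->] := HI v => /= xu xv.
  by move/asboolP: uv => /(_ _ _ (xu i) (xv i)); rewrite ltxx.
pose P i : {set line_graph G * line_graph G} := [set p | lt i p.1 p.2]%SET.
pose vv (p : line_graph G * line_graph G) := (val p.1, val p.2).
have vvI : injective vv.
  by move=> [x y] [z w] [/val_inj-> /val_inj->].
pose Q i : rel {set G} := fun e f => (e, f) \in [set vv p | p in P i]%SET.
have QP i e f : reflect (exists u v, [/\ e = val u, f = val v & lt i u v]) (Q i e f).
  apply: (iffP imsetP) => [[[u v]]|[u [v [-> -> uv]]]].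
    by rewrite inE => uv [-> ->]; exists u, v.
  by exists (u, v); rewrite ?inE.
have Qmio i : meeting_interval_order (Q i).
  split.
  - by move=> e f /QP[u [v [-> -> _]]]; split; apply: valP.
  - move=> e f /QP[u [v [-> -> /lt_adj]]] /= /andP[_ /existsP[x /andP[xu xv]]].
    by exists x.
  - by move=> e /QP[u [v [-> /val_inj <-]]]; rewrite lt_irr.
  - move=> e f e' f' /QP[u [v [-> -> uv]]] /QP[u' [v' [-> -> uv']]].
    have [H|H] := boolP (lt i u v'); first by left; apply/QP; exists u, v'.
    (* If [y <= x'], all [x] in [I u i] and [y'] in [I v' i] satisfy [x < y <= x' < y'], so [u]
       would precede [v']. *)
    right; apply/QP; exists u', v; split=> //; apply/asboolP => x' y Ix' Iy.
    rewrite ltNge; apply/negP => yx'; case/negP: H; apply/asboolP => x y' Ix Iy'.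
    move/asboolP: uv => /(_ _ _ Ix Iy) xy; move/asboolP: uv' => /(_ _ _ Ix' Iy').
    by apply: lt_trans; apply: lt_le_trans xy yx'.
have cQ i : #|[set p : {set G} * {set G} | Q i p.1 p.2]%SET| = #|P i|.
  rewrite -(card_imset (mem (P i)) vvI); congr #|pred_of_set _|; apply/setP => -[e f].
  by rewrite inE.
pose un (p : line_graph G * line_graph G) := [set p.1; p.2]%SET.
have cover : edges (line_graph G) \subset (\bigcup_(i < d) (un @: P i))%SET.
  apply/subsetP => _ /edgesP[[u v] /= uv ->].
  have neq : u != v by move: uv => /andP[].
  have [i dis] : exists i, forall x, ~ (I u i x /\ I v i x).
    apply: contrapT => /forallNP H.
    have /choice [x xP] : forall i, exists x, I u i x /\ I v i x.
      move=> i; have /existsNP[x /contrapT] := H i; by exists x.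
    have : (B u `&` B v !=set0)%classic.
      exists (\row_i x i); have [_ ->] := HI u; have [_ ->] := HI v.
      by split=> i /=; rewrite mxE; have [] := xP i.
    by move/(Badj u v neq); rewrite /= /compl_adj /= uv andbF.
  have [x0 Ix0] := Ine u i; have [y0 Iy0] := Ine v i.
  apply/bigcupP; exists i => //; apply/imsetP.
  have [xy|yx|xy] := ltgtP x0 y0.
  - exists (u, v); rewrite // inE /=; apply/asboolP.
    exact: disjoint_intervals_lt dis Ix0 Iy0 xy.
  - exists (v, u); last by rewrite /un /= setUC.
    rewrite inE /=; apply/asboolP; apply: disjoint_intervals_lt Iy0 Ix0 yx => //.
    by move=> x [xv xu]; apply: (dis x).
  - by case: (dis x0); rewrite {2}xy.
apply: (@leq_trans (2 * \sum_(i < d) #|P i|)%N).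
  rewrite leq_mul2l /=; apply: leq_trans (subset_leq_card cover) _.
  elim/big_ind2: _ => [|m A k C Am Ck|i _]; first by rewrite cards0.
    by apply: leq_trans (leq_card_setU _ _) _; apply: leq_add.
  exact: leq_imset_card.
rewrite big_distrr /= -[d in (_ <= d * _)%N]card_ord -sum_nat_const.
by apply: leq_sum => i _; rewrite -cQ; apply: HM.
Qed.

End LowerBound.

(** * The bounds in terms of the maximum degree *)

Unset Implicit Arguments.

Theorem theorem1p2 (R : realType) (G : sgraph) (n : nat) (Delta : nat)
    (hn : #|G| = n) (hDelta : max_degree G = Delta) (hDelta3 : (3 <= Delta)%N) :
  let H := line_graph G in
  let b := boxicity R (compl_graph H) in
  [/\ (b <= n - 2)%N,
      Delta = 3%N -> (#|edges H|%:R / 12%:R : R) <= b%:R,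
      Delta = 4%N -> (#|edges H|%:R / 16%:R : R) <= b%:R
    & (5 <= Delta)%N ->
      (2%:R * #|edges H|%:R / (Delta%:R ^+ 2 + 3%:R * Delta%:R) : R) <= b%:R].
Proof.
move=> H b.
have degD (x : G) : (#|nbrs x| <= Delta)%N.
  by rewrite -hDelta /max_degree (leq_bigmax x).
have : (2 * #|edges H| <= b * maxn (8 * Delta) (Delta ^ 2 + 3 * Delta))%N.
  apply: card_edges_line; first exact: box_representable_boxicity.
  by move=> Q Qmio; apply: count_mio.
have -> : (2 * #|edges H| <= b * maxn (8 * Delta) (Delta ^ 2 + 3 * Delta))%N =
  (2%:R * #|edges H|%:R <= b%:R * (maxn (8 * Delta) (Delta ^ 2 + 3 * Delta))%:R :> R).
  by rewrite -!natrM ler_nat.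
move=> bound; split.
- have : (1 < #|G|)%N.
    apply: leq_trans (_ : max_degree G <= #|G|)%N; first by rewrite hDelta ltnW.
    by apply/bigmax_leqP => x _; apply: max_card.
  rewrite -cardsT => /card_gt1P[x [y [_ _ xy]]]; rewrite -hn.
  by apply: boxicity_le; apply: box_representable_compl_line xy.
(* For degrees 3 and 4 the maximum is [8 * Delta], that is 24 and 32, twice the stated
   denominators. *)
- move=> D3; rewrite ler_pdivrMr ?ltr0n //.
  rewrite D3 in bound; move: bound.
  have -> : maxn (8 * 3) (3 ^ 2 + 3 * 3) = 24%N by []; lra.
- move=> D4; rewrite ler_pdivrMr ?ltr0n //.
  rewrite D4 in bound; move: bound.
  have -> : maxn (8 * 4) (4 ^ 2 + 3 * 4) = 32%N by []; lra.
- move=> D5; have -> : Delta%:R ^+ 2 + 3%:R * Delta%:R = (Delta ^ 2 + 3 * Delta)%:R :> R.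
    by rewrite natrD natrX natrM.
  rewrite ler_pdivrMr ?ltr0n ?addn_gt0 ?expn_gt0; last by lia.
  by move: bound; have /maxn_idPr -> : (8 * Delta <= Delta ^ 2 + 3 * Delta)%N by nia.
Qed.
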